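(* Let $f:\mathbb{R}^d\to\mathbb{R}\cup\{-\infty\}$ be a piecewise linear concave function. Let $\Delta$ be the polyhedral subdivision of the effective domain of $f$ whose cells are the regions of linearity of $f$. Then $f$ is supermodular if and only if each cell of $\Delta$ is min-max closed, i.e. defined by bimonotone linear inequalities.
   Context: For $x,y\in\mathbb{R}^d$, $x\wedge y$ and $x\vee y$ are the coordinatewise minimum and maximum. The effective domain of $f$ is $\{x: f(x)>-\infty\}$. A piecewise linear concave function is one whose effective domain is a union of finitely many convex polyhedra on each of which $f$ is affine; the regions of linearity are the maximal convex polyhedra on which $f$ is affine, and these (together with their faces) form the polyhedral complex $\Delta$. $f$ is supermodular if $f(x)+f(y)\le f(x\wedge y)+f(x\vee y)$ for all $x,y\in\mathbb{R}^d$. A set is min-max closed if it contains $u\wedge v$ and $u\vee v$ whenever it contains $u$ and $v$. A linear inequality on $\mathbb{R}^d$ is bimonotone if it has the form $a_iz_i+a_jz_j\ge b$ for some indices $i\ne j$ with $a_ia_j\le 0$. (A convex polyhedron is min-max closed if and only if it is the solution set of finitely many bimonotone linear inequalities.)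
   Formalization: The ''i.e. defined by bimonotone linear inequalities'' is claimed only for d ≠ 1, since for d = 1 there are no two distinct indices and [0,1] is min-max closed but not so defined; the equivalence of supermodularity with min-max closed cells is for all d. *)

(* Defs.v *)
From HB Require Import structures.
From mathcomp Require Import all_boot all_order all_algebra.
From mathcomp Require Import boolp classical_sets reals constructive_ereal.

Set Implicit Arguments.
Unset Strict Implicit.
Unset Printing Implicit Defensive.

Import Order.TTheory GRing.Theory Num.Theory.

Local Open Scope classical_set_scope.
Local Open Scope ring_scope.

Section Polyhedra.
Context {R : realType} {d : nat}.
Implicit Types (x y : 'cV[R]_d) (P F : set 'cV[R]_d).

Definition vmin x y : 'cV[R]_d := map2_mx Num.min x y.
Definition vmax x y : 'cV[R]_d := map2_mx Num.max x y.

Definition minmax_closed P : Prop :=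
  forall u v, P u -> P v -> P (vmin u v) /\ P (vmax u v).

Definition solution_set (m : nat) (A : 'M[R]_(m, d)) (b : 'cV[R]_m) :
    set 'cV[R]_d :=
  [set x | forall r : 'I_m, b r 0 <= (A *m x) r 0].

Definition polyhedron P : Prop :=
  exists (m : nat) (A : 'M[R]_(m, d)) (b : 'cV[R]_m), P = solution_set A b.

(* The inequality [a z >= b] is bimonotone when it only involves two variables
   [z_i], [z_j], with [a_i * a_j <= 0]; the constant [b] is irrelevant.  As the
   indices [i], [j] are distinct, there is no such inequality when [d <= 1]. *)
Definition bimonotone (a : 'rV[R]_d) : Prop :=
  exists i j : 'I_d,
    [/\ i != j, a 0 i * a 0 j <= 0 &
        forall k : 'I_d, k != i -> k != j -> a 0 k = 0].

Definition bimonotone_polyhedron P : Prop :=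
  exists (m : nat) (A : 'M[R]_(m, d)) (b : 'cV[R]_m),
    (forall r : 'I_m, bimonotone (row r A)) /\ P = solution_set A b.

(* [a = 0], [b = 0] shows that [P] is a face of itself. *)
Definition face F P : Prop :=
  exists (a : 'rV[R]_d) (b : R),
    (forall x, P x -> b <= (a *m x) 0 0) /\
    F = P `&` [set x | (a *m x) 0 0 = b].

End Polyhedra.

Section ExtendedFunctions.
Context {R : realType} {d : nat}.
Implicit Types (f : 'cV[R]_d -> \bar R) (P C : set 'cV[R]_d).

Local Open Scope ereal_scope.

Definition effective_domain f : set 'cV[R]_d := [set x | -oo < f x].

(* For [t = 0] or [t = 1] the convention [0 * -oo = 0] makes this trivial. *)
Definition concave f : Prop :=
  forall (x y : 'cV[R]_d) (t : R), (0 <= t <= 1)%R ->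
    t%:E * f x + (1 - t)%:E * f y <= f (t *: x + (1 - t) *: y)%R.

Definition affine_on f P : Prop :=
  exists (a : 'rV[R]_d) (c : R), forall x, P x -> f x = ((a *m x) 0 0 + c)%:E.

(* The first conjunct says that [f] takes values in R \cup {-oo}. *)
Definition piecewise_linear_concave f : Prop :=
  [/\ forall x, f x != +oo,
      concave f &
      exists (n : nat) (P : 'I_n -> set 'cV[R]_d),
        (forall k, polyhedron (P k) /\ affine_on f (P k)) /\
        effective_domain f = \bigcup_(k in [set: 'I_n]) P k].

Definition supermodular f : Prop :=
  forall x y, f x + f y <= f (vmin x y) + f (vmax x y).

Definition region_of_linearity f P : Prop :=
  [/\ polyhedron P, affine_on f P &
      forall Q : set 'cV[R]_d,
        polyhedron Q -> affine_on f Q -> P `<=` Q -> Q = P].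

Definition cell f C : Prop :=
  C !=set0 /\ exists P, region_of_linearity f P /\ face C P.

End ExtendedFunctions.

(* Main.v *)
Require Import Defs.
From HB Require Import structures.
From mathcomp Require Import all_boot all_order all_algebra.
From mathcomp Require Import boolp classical_sets reals constructive_ereal.
From mathcomp Require Import ring lra.

(* The hypograph of [f] is convex and a finite union of polyhedra; a Balas
   lifting followed by Fourier-Motzkin elimination shows that it is a polyhedron,
   so [f] is the minimum of finitely many affine forms [l j] on a polyhedral
   domain.  The regions of linearity are the maximal sets among the
   [{x | f x = l j x}].

   If [f] is supermodular and [f u = l u], [f v = l v] with [l >= f], then
   modularity of [l] forces equality at [min u v] and [max u v], so regions are
   min-max closed, and so are their faces.

   Conversely, the segment from [x] to [y] is the diagonal of a rectangle whose
   other corners are [min x y] and [max x y].  Any point of the rectangle close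
   enough to a given one shares a min-max closed region with it.  Where two such
   points are opposite on an increasing diagonal, the other two corners
   lie in the region and [f] is modular on the small rectangle; where they are
   opposite on a decreasing diagonal, [f] is affine along that diagonal and
   concavity at the midpoint gives the inequality.  Subdividing the rectangle adds
   up these inequalities.

   A min-max closed polyhedron is the intersection of its projections to pairs of
   coordinates (Baker-Pixley), and in a planar min-max closed polyhedron an
   inequality with two coefficients of the same sign follows from bounds on
   single coordinates. *)

Set Implicit Arguments.
Unset Strict Implicit.
Unset Printing Implicit Defensive.

Import Order.TTheory GRing.Theory Num.Theory.

Local Open Scope classical_set_scope.
Local Open Scope ring_scope.

(** * Polyhedral sets and Fourier-Motzkin elimination *)

Section Polyhedral.
Context {R : realType}.

Definition linform (V : lmodType R) (g : V -> R) : Prop :=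
  forall t x y, g (t *: x + y) = t * g x + g y.

(** The class [Pr] of admissible forms is a parameter so that the same closure properties serve
    arbitrary polyhedra and those described by bimonotone forms. *)
Definition cut_out (V : lmodType R) (Pr : (V -> R) -> Prop) (P : set V) : Prop :=
  exists (I : finType) (g : I -> V -> R) (c : I -> R),
    (forall i, Pr (g i)) /\ P = [set x | forall i, c i <= g i x].

Definition polyhedral (V : lmodType R) : set V -> Prop := cut_out (@linform V).

Definition convex (V : lmodType R) (P : set V) : Prop :=
  forall (t : R) x y, 0 <= t <= 1 -> P x -> P y -> P (t *: x + (1 - t) *: y).

Lemma linform0 (V : lmodType R) (g : V -> R) : linform g -> g 0 = 0.
Proof. by move=> lg; have := lg 1 0 0; rewrite scaler0 addr0; lra. Qed.

Lemma linformD (V : lmodType R) (g : V -> R) x y :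
  linform g -> g (x + y) = g x + g y.
Proof. by move=> lg; have := lg 1 x y; rewrite scale1r mul1r. Qed.

Lemma linformZ (V : lmodType R) (g : V -> R) t x :
  linform g -> g (t *: x) = t * g x.
Proof. by move=> lg; have := lg t x 0; rewrite (linform0 lg) !addr0. Qed.

Lemma linformN (V : lmodType R) (g : V -> R) x : linform g -> g (- x) = - g x.
Proof. by move=> lg; rewrite -scaleN1r linformZ // mulN1r. Qed.

Lemma linformB (V : lmodType R) (g : V -> R) x y :
  linform g -> g (x - y) = g x - g y.
Proof. by move=> lg; rewrite linformD // linformN. Qed.

Lemma eq_polyhedral (V : lmodType R) (P Q : set V) :
  (forall x, P x <-> Q x) -> polyhedral P -> polyhedral Q.
Proof. by move=> PQ; rewrite (_ : P = Q) //; apply/seteqP; split=> x /PQ. Qed.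

Lemma cut_out_halfspace (V : lmodType R) (Pr : (V -> R) -> Prop) g c :
  Pr g -> cut_out Pr [set x | c <= g x].
Proof.
move=> lg; exists unit, (fun=> g), (fun=> c); split=> //.
by apply/seteqP; split=> x /= h; [move=> _ | exact: h tt].
Qed.

Lemma cut_out_bigcap (V : lmodType R) (Pr : (V -> R) -> Prop) (J : finType)
    (P : J -> set V) :
  (forall j, cut_out Pr (P j)) -> cut_out Pr [set x | forall j, P j x].
Proof.
move=> pP.
pose I j := projT1 (cid (pP j)).
have H j : exists g : (I j -> V -> R) * (I j -> R),
    (forall i, Pr (g.1 i)) /\ P j = [set x | forall i, g.2 i <= g.1 i x].
  rewrite /I; case: (cid (pP j)) => I0 /= [g [c h]]; by exists (g, c).
pose G j := projT1 (cid (H j)).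
have hG j := projT2 (cid (H j)).
exists {j : J & I j}, (fun i => (G (tag i)).1 (tagged i)),
  (fun i => (G (tag i)).2 (tagged i)); split.
  by case=> j i; exact: (hG j).1.
apply/seteqP; split=> x /=.
  by move=> hx [j i] /=; move: (hx j); rewrite [P j](hG j).2; exact.
by move=> hx j; rewrite [P j](hG j).2 => i; exact: (hx (Tagged I i)).
Qed.

Lemma cut_outI (V : lmodType R) (Pr : (V -> R) -> Prop) (P Q : set V) :
  cut_out Pr P -> cut_out Pr Q -> cut_out Pr (P `&` Q).
Proof.
move=> pP pQ.
have := @cut_out_bigcap V Pr bool (fun b => if b then P else Q).
rewrite (_ : [set x | _] = P `&` Q); first by apply; case.
apply/seteqP; split=> x /=; first by move=> h; split; [exact: h true|exact: h false].
by move=> [? ?] [].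
Qed.

Lemma polyhedral_halfspace (V : lmodType R) (g : V -> R) (c : R) :
  linform g -> polyhedral [set x | c <= g x].
Proof. exact: cut_out_halfspace. Qed.

Lemma polyhedral_bigcap (V : lmodType R) (J : finType) (P : J -> set V) :
  (forall j, polyhedral (P j)) -> polyhedral [set x | forall j, P j x].
Proof. exact: cut_out_bigcap. Qed.

Lemma polyhedralI (V : lmodType R) (P Q : set V) :
  polyhedral P -> polyhedral Q -> polyhedral (P `&` Q).
Proof. exact: cut_outI. Qed.

Lemma polyhedral_cond (V : lmodType R) (b : Prop) (P : set V) :
  polyhedral P -> polyhedral [set x | b -> P x].
Proof.
move=> pP; have [hb|hb] := pselect b.
  by apply: eq_polyhedral pP => x; split=> //=; exact.
have := @polyhedral_bigcap V void (fun=> setT) (fun j => match j with end).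
by apply: eq_polyhedral => x; split=> // _ /hb.
Qed.

Lemma polyhedral_preimage (V W : lmodType R) (phi : V -> W) (P : set W) :
  linear phi -> polyhedral P -> polyhedral [set x | P (phi x)].
Proof.
move=> lphi [I [g [c [lg ->]]]].
exists I, (fun i x => g i (phi x)), c; split=> // i t x y.
by rewrite lphi lg.
Qed.

Lemma polyhedral_convex (V : lmodType R) (P : set V) :
  polyhedral P -> convex P.
Proof.
move=> [I [g [c [lg ->]]]] t x y /andP[t0 t1] hx hy i /=.
rewrite linformD // !linformZ //; have := hx i; have := hy i; nra.
Qed.

Lemma finite_min_pos (I : finType) (A : I -> R -> Prop) :
  (forall i, exists2 e, 0 < e & forall r, 0 < r -> r <= e -> A i r) ->
  exists2 e, 0 < e & forall i r, 0 < r -> r <= e -> A i r.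
Proof.
move=> h.
suff [e e0 he] : exists2 e, 0 < e &
    forall i, i \in enum I -> forall r, 0 < r -> r <= e -> A i r.
  by exists e => // i r; apply: he; rewrite mem_enum.
elim: (enum I) => [|i s [e e0 he]]; first by exists 1.
have [e' e'0 he'] := h i.
exists (Num.min e e') => [|j]; first by rewrite lt_min e0.
rewrite inE => /predU1P[->|js] r r0; rewrite le_min => /andP[re re'].
  exact: he'.
exact: he.
Qed.

(** An inequality violated at [z] stays violated under small moves along [p] and [q]. *)
Lemma polyhedral_open_compl (V : lmodType R) (P : set V) (z p q : V) :
  polyhedral P -> ~ P z ->
  exists2 r, 0 < r &
    forall a b, `|a| <= r -> `|b| <= r -> ~ P (z + a *: p + b *: q).
Proof.
move=> [I [g [c [lg ->]]]] /=; rewrite -existsNE => -[i /negP].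
rewrite -ltNge => hi.
(* The summand 1 makes [K] positive; the radius is chosen so that [r * K] is half the amount by
   which inequality [i] fails at [z]. *)
pose K := `|g i p| + `|g i q| + 1.
have K0 : 0 < K by rewrite ltr_wpDl // addr_ge0.
exists ((c i - g i z) / (2 * K)); first by rewrite divr_gt0 ?mulr_gt0 // subr_gt0.
set r := _ / _ => a b ha hb /(_ i).
apply/negP; rewrite -ltNge !linformD // !linformZ //.
have rK : r * K * 2 = c i - g i z by rewrite /r; field; rewrite gt_eqF.
have r0 : 0 <= r by apply: le_trans ha.
have h1 : a * g i p <= r * `|g i p|.
  by rewrite (le_trans (ler_norm _)) // normrM ler_wpM2r.
have h2 : b * g i q <= r * `|g i q|.
  by rewrite (le_trans (ler_norm _)) // normrM ler_wpM2r.
by rewrite /K in rK; nra.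
Qed.

(** The largest lower bound serves as [t]; without lower bounds the smallest upper bound does. *)
Lemma between_families (I J : finType) (l : I -> R) (u : J -> R) (A : pred I)
    (B : pred J) :
  (forall i j, A i -> B j -> l i <= u j) ->
  exists t, (forall i, A i -> l i <= t) /\ (forall j, B j -> t <= u j).
Proof.
move=> h.
have [[i0 Ai0]|nA] := pselect (exists i, A i).
  case: (arg_maxP l Ai0) => i Ai hi; exists (l i); split=> // j Bj; exact: h.
have [[j0 Bj0]|nB] := pselect (exists j, B j).
  case: (arg_minP u Bj0) => j Bj hj; exists (u j); split=> // i Ai.
  by case: nA; exists i.
by exists 0; split=> [i Ai|j Bj]; [case: nA; exists i|case: nB; exists j].
Qed.

(** One Fourier-Motzkin step eliminating [t]: inequalities whose form vanishes on [v] are kept, and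
    each lower bound on [t] (indices in [A]) is paired with each upper bound (indices in [B]),
    denominators cleared. *)
Lemma polyhedral_add_line (V : lmodType R) (P : set V) (v : V) :
  polyhedral P -> polyhedral [set x | exists t, P (x + t *: v)].
Proof.
move=> [I [g [c [lg ->]]]].
pose al i := g i v.
pose A := [pred i | 0 < al i]; pose B := [pred i | al i < 0].
have -> : [set x | exists t, forall i, c i <= g i (x + t *: v)] =
    [set x | forall i, al i = 0 -> c i <= g i x] `&`
    [set x | forall ij : I * I, A ij.1 -> B ij.2 ->
       al ij.1 * c ij.2 - al ij.2 * c ij.1 <= al ij.1 * g ij.2 x - al ij.2 * g ij.1 x].
  apply/seteqP; split=> x /=.
    move=> [t ht]; split.
      by move=> i ai; have := ht i; rewrite linformD // linformZ // -/(al i) ai; lra.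
    move=> [i j] /= Ai Bj; have := ht i; have := ht j.
    by rewrite !linformD // !linformZ // -/(al i) -/(al j); nra.
  move=> [h0 h].
  have [|t [ht1 ht2]] := @between_families I I
    (fun i => (c i - g i x) / al i) (fun i => (c i - g i x) / al i) A B.
    move=> i j Ai Bj; have /= := h (i, j) Ai Bj.
    rewrite /= in Ai Bj.
    rewrite ler_pdivrMr // mulrAC ler_ndivlMr //; nra.
  exists t => i; rewrite linformD // linformZ // -/(al i).
  case: (ltgtP (al i) 0) => ai.
  - by have := ht2 i ai; rewrite ler_ndivlMr //; lra.
  - by have := ht1 i ai; rewrite ler_pdivrMr //; lra.
  - by have := h0 i ai; rewrite ai; lra.
apply: polyhedralI.
  by apply: polyhedral_bigcap => i; apply/polyhedral_cond/polyhedral_halfspace.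
apply: polyhedral_bigcap => -[i j].
have lij : linform (fun x => al i * g j x - al j * g i x).
  by move=> t x y; rewrite !lg; ring.
by apply/polyhedral_cond/polyhedral_cond; exact: (polyhedral_halfspace _ lij).
Qed.

Lemma polyhedral_add_span (V : lmodType R) (P : set V) n (b : 'I_n -> V) :
  polyhedral P ->
  polyhedral [set x | exists t : 'I_n -> R, P (x + \sum_i t i *: b i)].
Proof.
elim: n b P => [|n IH] b P pP.
  rewrite (_ : [set x | _] = P) //; apply/seteqP; split=> x /=.
    by move=> [t]; rewrite big_ord0 addr0.
  by exists (fun=> 0); rewrite big_ord0 addr0.
have := IH (b \o lift ord0) _ (polyhedral_add_line (b ord0) pP).
congr polyhedral; apply/seteqP; split=> x /= [t].
  move=> [s hs]; exists (fun i => if unlift ord0 i is Some j then t j else s).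
  rewrite big_ord_recl unlift_none; under eq_bigr do rewrite liftK.
  by rewrite (addrC (s *: _)) addrA.
rewrite big_ord_recl => ht; exists (t \o lift ord0), (t ord0).
by rewrite -addrA (addrC (\sum_i _)).
Qed.

(** Projecting [W] away amounts to adding the span of the vectors [(0, b_i)], for a basis [b] of
    [W], and then restricting to the points [(x, 0)]. *)
Lemma polyhedral_exists (V : lmodType R) (W : vectType R) (S : set (V * W)) :
  polyhedral S -> polyhedral [set x | exists w, S (x, w)].
Proof.
move=> pS; set b := vbasis (@fullv R W).
have lphi : linear (fun x : V => (x, 0) : V * W).
  by move=> t x y; congr pair; rewrite /= ?scaler0 ?addr0.
apply: eq_polyhedral (polyhedral_preimage lphi
  (polyhedral_add_span (fun i : 'I_(\dim (@fullv R W)) => (0, b`_i) : V * W) pS)).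
move=> x /=; split.
  move=> [t]. set y := _ + _ => hy; exists y.2.
  suff -> : (x, y.2) = y by [].
  rewrite [RHS]surjective_pairing; congr pair.
  rewrite /y /= raddf_sum /= big1 ?addr0 // => i _.
  by rewrite scaler0.
move=> [w hw]; exists (fun i => coord b i w).
suff -> : (x, 0) + \sum_i coord b i w *: (0, b`_i) = (x, w) :> V * W by [].
rewrite [LHS]surjective_pairing; congr pair.
  by rewrite /= raddf_sum /= big1 ?addr0 // => i _; rewrite scaler0.
by rewrite /= raddf_sum /= add0r [RHS](coord_vbasis (memvf w)).
Qed.

End Polyhedral.

(** * Convex finite unions of polyhedra *)

Section Union.
Context {R : realType}.

(** Closedness tested only along segments, which makes sense without a topology on [V]. *)
Definition line_closed (V : lmodType R) (P : set V) : Prop :=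
  forall x w, (forall t : R, 0 < t <= 1 -> P (x + t *: w)) -> P x.

Lemma line_closed_bigcup (V : lmodType R) (J : finType) (P : J -> set V) :
  (forall j, polyhedral (P j)) -> line_closed [set x | exists j, P j x].
Proof.
move=> pP x w h; apply: contrapT => /= /forallNP hn.
have [e e0 he] : exists2 e, 0 < e & forall j r, 0 < r -> r <= e -> ~ P j (x + r *: w).
  apply: finite_min_pos => j.
  have [e e0 he] := polyhedral_open_compl w 0 (pP j) (hn j); exists e => // r r0 re.
  have := he r 0; rewrite scaler0 addr0 normr0; apply; last exact: ltW.
  by rewrite ger0_norm // ltW.
have [|j] := h (Num.min e 1); first by rewrite lt_min e0 ltr01 ge_min lexx orbT.
by apply: he; rewrite ?lt_min ?e0 ?ltr01 // ge_min lexx.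
Qed.

(** The combination of [p + t^-1 *: y] and [u] with weights [t] and [1 - t] lies in [U] and tends to
    [u + y] along a line as [t] goes to 0. *)
Lemma recession_mem (V : lmodType R) (U : set V) (p u y : V) :
  convex U -> line_closed U -> U u ->
  (forall t : R, 0 <= t -> U (p + t *: y)) -> U (u + y).
Proof.
move=> cU lU hu hp; apply: (lU _ (p - u)) => t /andP[t0 t1].
have -> : u + y + t *: (p - u) = t *: (p + t^-1 *: y) + (1 - t) *: u.
  rewrite [in RHS]scalerDr scalerA mulfV ?gt_eqF // scale1r scalerBl scale1r.
  by rewrite scalerBr addrACA [RHS]addrACA (addrC u).
apply: cU => //; first by rewrite ltW.
by apply: hp; rewrite invr_ge0 ltW.
Qed.

(* Balas: the homogenised system in [(y, l)] and [(x - y, 1 - l)]; its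
   solutions with [l = 0] or [l = 1] contribute recession directions. *)
Lemma polyhedral_hull2 (V : vectType R) (U P Q : set V) :
  convex U -> line_closed U -> polyhedral P -> polyhedral Q ->
  P `<=` U -> Q `<=` U ->
  exists H : set V, [/\ polyhedral H, P `<=` H, Q `<=` H & H `<=` U].
Proof.
move=> cU lU pP pQ PU QU.
have [[p hp]|nP] := pselect (P !=set0); last first.
  by exists Q; split=> // x Px; case: nP; exists x.
have [[q hq]|nQ] := pselect (Q !=set0); last first.
  by exists P; split=> // x Qx; case: nQ; exists x.
case: pP => I [g [c [lg eP]]]; case: pQ => J [k [d [lk eQ]]].
pose S : set (V * (V * R^o)) := [set z |
  [/\ forall i, z.2.2 * c i <= g i z.2.1,
      forall j, (1 - z.2.2) * d j <= k j (z.1 - z.2.1), 0 <= z.2.2 & z.2.2 <= 1]].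
have pS : polyhedral S.
  have lin2 (a : R) (b e : V -> R) : linform b -> linform e ->
      linform (fun z : V * (V * R^o) => b z.1 + e z.2.1 + a * z.2.2).
    by move=> lb le t x y; rewrite /= lb le /GRing.scale /=; ring.
  have l0 : linform (fun _ : V => 0 : R) by move=> *; rewrite mulr0 addr0.
  have lN (b : V -> R) : linform b -> linform (fun x => - b x).
    by move=> lb t x y; rewrite lb; ring.
  apply: eq_polyhedral (polyhedralI (polyhedralI
    (polyhedral_bigcap (fun i => polyhedral_halfspace 0 (lin2 (- c i) _ _ l0 (lg i))))
    (polyhedral_bigcap (fun j => polyhedral_halfspace (d j)
       (lin2 (d j) _ _ (lk j) (lN _ (lk j))))))
    (polyhedralI (polyhedral_halfspace 0 (lin2 1 _ _ l0 l0))
       (polyhedral_halfspace (-1) (lin2 (-1) _ _ l0 l0)))).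
  move=> [x [y l]] /=; split.
    case=> -[h1 h2] [h3 h4]; split=> /=; [| |lra|lra].
      by move=> i; have := h1 i => /=; lra.
    by move=> j; have := h2 j => /=; rewrite linformB //; lra.
  case=> /= h1 h2 h3 h4; split; split=> /=; [| |lra|lra].
    by move=> i /=; have := h1 i => /=; lra.
  by move=> j /=; have := h2 j; rewrite linformB //; lra.
exists [set x | exists w, S (x, w)]; split.
- exact: polyhedral_exists.
- move=> x; rewrite eP /= => hx; exists (x, 1); split=> //= [i|j].
    by rewrite mul1r.
  by rewrite !subrr mul0r linform0.
- move=> x; rewrite eQ /= => hx; exists (0, 0); split=> //= [i|j].
    by rewrite mul0r linform0.
  by rewrite !subr0 mul1r.
move=> x [[y l]] [/= h1 h2 h3 h4].
have [l0|l0] := eqVneq l 0.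
  rewrite -(subrK y x); apply: (@recession_mem _ _ p) => //.
    apply: QU; rewrite eQ => j /=.
    by have := h2 j; rewrite l0 subr0 mul1r.
  move=> t t0; apply: PU; rewrite eP => i /=.
  rewrite linformD // linformZ //.
  have := h1 i; rewrite l0 mul0r => h.
  by move: hp; rewrite eP => /(_ i) /=; nra.
have [l1|l1] := eqVneq l 1.
  rewrite -(subrK y x) addrC; apply: (@recession_mem _ _ q) => //.
    apply: PU; rewrite eP => i /=.
    by have := h1 i; rewrite l1 mul1r.
  move=> t t0; apply: QU; rewrite eQ => j /=.
  rewrite linformD // linformZ //.
  have := h2 j; rewrite l1 subrr mul0r => h.
  by move: hq; rewrite eQ => /(_ j) /=; nra.
have {}l0 : 0 < l by rewrite lt_def l0.
have {}l1 : 0 < 1 - l by rewrite subr_gt0 lt_def eq_sym l1.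
(* For [0 < l < 1] rescaling gives a point of [P] and a point of [Q] with [x] between them. *)
have -> : x = l *: (l^-1 *: y) + (1 - l) *: ((1 - l)^-1 *: (x - y)).
  by rewrite !scalerA !mulfV ?gt_eqF // !scale1r addrC subrK.
apply: cU; first by rewrite h3.
  apply: PU; rewrite eP => i /=; rewrite linformZ // mulrC ler_pdivlMr //.
  by rewrite mulrC.
apply: QU; rewrite eQ => j /=; rewrite linformZ // mulrC ler_pdivlMr //.
by rewrite mulrC.
Qed.

Lemma polyhedral_set0 (V : lmodType R) : polyhedral (@set0 V).
Proof.
exists unit, (fun _ _ => 0), (fun=> 1); split=> [_ t x y|].
  by rewrite mulr0 addr0.
by apply/seteqP; split=> x //= /(_ tt); rewrite ler10.
Qed.

(** A polyhedral set inside the union absorbs the [P k] one at a time without leaving the union, and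
    finally equals it. *)
Lemma polyhedral_convex_bigcup (V : vectType R) (n : nat) (P : 'I_n -> set V) :
  (forall k, polyhedral (P k)) -> convex [set x | exists k, P k x] ->
  polyhedral [set x | exists k, P k x].
Proof.
move=> pP cU; set U := [set x | _] in cU *.
have lU : line_closed U by exact: line_closed_bigcup.
suff [H [pH sH HU]] : exists H : set V,
    [/\ polyhedral H, forall k, k \in enum 'I_n -> P k `<=` H & H `<=` U].
  apply: eq_polyhedral pH => x; split; first exact: HU.
  by move=> [k]; apply: sH; rewrite mem_enum.
elim: (enum _) => [|k s [H [pH sH HU]]].
  by exists set0; split=> //; exact: polyhedral_set0.
have [|H' [pH' h1 h2 h3]] := polyhedral_hull2 cU lU (pP k) pH _ HU.
  by move=> x Px; exists k.
exists H'; split=> // k'; rewrite inE => /predU1P[->//|ks] x Px.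
by apply: h2; exact: (sH _ ks).
Qed.

Lemma linform_rowP d (g : 'cV[R]_d -> R) : linform g ->
  exists a : 'rV[R]_d, forall x, g x = (a *m x) 0 0.
Proof.
move=> lg; exists (\row_k g (delta_mx k 0)) => x.
rewrite mxE [in LHS](matrix_sum_delta x).
under eq_bigr do rewrite big_ord1.
have lsum (s : seq 'I_d) : g (\sum_(i <- s) x i 0 *: delta_mx i 0) =
    \sum_(i <- s) g (delta_mx i 0) * x i 0.
  elim: s => [|i s IH]; first by rewrite !big_nil linform0.
  by rewrite !big_cons lg IH mulrC.
by rewrite lsum; apply: eq_bigr => i _; rewrite mxE.
Qed.

Lemma linform_row d (a : 'rV[R]_d) : linform (fun x : 'cV_d => (a *m x) 0 0).
Proof. by move=> t x y; rewrite mulmxDr -scalemxAr !mxE. Qed.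

(** Passage between matrix systems and families over a finite type; the condition [Pr] on rows is
    trivial for polyhedra and is [bimonotone] later. *)
Lemma solution_setP d (Pr : 'rV[R]_d -> Prop) (P : set 'cV[R]_d) :
  (exists m (A : 'M[R]_(m, d)) (b : 'cV[R]_m),
     (forall r, Pr (row r A)) /\ P = solution_set A b) <->
  (exists (I : finType) (a : I -> 'rV[R]_d) (c : I -> R),
     (forall i, Pr (a i)) /\ P = [set x | forall i, c i <= (a i *m x) 0 0]).
Proof.
split=> [[m [A [b [hA ->]]]]|[I [a [c [ha ->]]]]].
  exists 'I_m, (fun r => row r A), (fun r => b r 0); split=> //.
  by apply/seteqP; split=> x /= h r; have := h r; rewrite -row_mul [in X in _ -> X]mxE ?mxE.
exists #|I|, (\matrix_r a (enum_val r)), (\col_r c (enum_val r)); split.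
  by move=> r; rewrite rowK.
have E x r : ((\matrix_r a (enum_val r)) *m x) r 0 = (a (enum_val r) *m x) 0 0.
  by rewrite !mxE; apply: eq_bigr => k _; rewrite mxE.
apply/seteqP; split=> x /= h.
  by move=> r; rewrite E mxE.
by move=> i; have := h (enum_rank i); rewrite E mxE enum_rankK.
Qed.

Lemma polyhedronE d (P : set 'cV[R]_d) : polyhedron P <-> polyhedral P.
Proof.
split=> [[m [A [b ->]]]|[I [g [c [lg ->]]]]].
  exists 'I_m, (fun r x => (A *m x) r 0), (fun r => b r 0); split=> //.
  by move=> r t x y; rewrite mulmxDr -scalemxAr !mxE.
have ha i := linform_rowP (lg i).
pose a i := projT1 (cid (ha i)).
have [|m [A [b [_ e]]]] := (solution_setP (fun=> True) [set x | forall i, c i <= g i x]).2.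
  exists I, a, c; split=> //.
  by apply/seteqP; split=> x /= h i; have := h i; rewrite (projT2 (cid (ha i))).
by exists m, A, b.
Qed.

End Union.

(** * Affine pieces of a piecewise linear concave function *)

Section Pieces.
Context {R : realType} {d : nat}.
Implicit Types (f : 'cV[R]_d -> \bar R).

Definition affine_form (a : 'rV[R]_d) (c : R) (x : 'cV[R]_d) : R :=
  (a *m x) 0 0 + c.

Lemma affine_form_mix a c t x y :
  affine_form a c (t *: x + (1 - t) *: y) =
  t * affine_form a c x + (1 - t) * affine_form a c y.
Proof.
rewrite /affine_form (linform_row a) (linformZ _ _ (linform_row a)).
by ring.
Qed.

Definition piece f a c : set 'cV[R]_d := [set x | f x = (affine_form a c x)%:E].

Lemma effective_domain_fin f x :
  f x != +oo%E -> effective_domain f x -> exists r, f x = r%:E.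
Proof. by rewrite /effective_domain /=; case: (f x) => [r||] //; exists r. Qed.

Lemma convex_hypograph f : (forall x, f x != +oo%E) -> concave f ->
  convex [set z : 'cV[R]_d * R^o | (z.2%:E <= f z.1)%E].
Proof.
move=> fy cf t [x r] [y s] /= t01 hr hs.
have [t0 t1] := andP t01.
apply: le_trans (cf x y t t01).
rewrite EFinD !EFinM; apply: leeD; apply: lee_wpmul2l => //.
by rewrite lee_fin subr_ge0.
Qed.

(* The affine forms are the inequalities defining the hypograph in which the last
   coordinate has a non-zero coefficient, which must be negative. *)
Lemma plc_pieces f : piecewise_linear_concave f ->
  exists (J : finType) (a : J -> 'rV[R]_d) (c : J -> R),
  [/\ forall j, polyhedral (piece f (a j) (c j)),
      forall j x, (f x <= (affine_form (a j) (c j) x)%:E)%E &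
      forall x, effective_domain f x -> exists j, piece f (a j) (c j) x].
Proof.
move=> [fy cf [n [P [hP eD]]]].
(* An empty domain is covered by the empty family of forms; otherwise [x0] serves to determine the
   sign of the coefficients [al i]. *)
have [[x0 Dx0]|nD] := pselect (effective_domain f !=set0); last first.
  exists void, (fun=> 0), (fun=> 0); split=> [[]|[]|x Dx]; by case: nD; exists x.
pose H : set ('cV[R]_d * R^o) := [set z | (z.2%:E <= f z.1)%E].
have [ak hak] : exists ak : 'I_n -> 'rV[R]_d * R,
    forall k x, P k x -> f x = (affine_form (ak k).1 (ak k).2 x)%:E.
  have h k : exists p : 'rV[R]_d * R, forall x, P k x -> f x = (affine_form p.1 p.2 x)%:E.
    by have [_ [a [c h]]] := hP k; exists (a, c).
  by exists (fun k => projT1 (cid (h k))) => k; exact: projT2 (cid (h k)).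
pose HP k : set ('cV[R]_d * R^o) :=
  [set z | P k z.1 /\ z.2 <= affine_form (ak k).1 (ak k).2 z.1].
have eH : H = [set z | exists k, HP k z].
  apply/seteqP; split=> -[x r] /=; rewrite /H /HP /=.
    move=> hr; have Dx : effective_domain f x.
      by apply: lt_le_trans hr; exact: ltNyr.
    move: (Dx); rewrite eD => -[k _ Pk]; exists k; split=> //.
    by rewrite -lee_fin -hak.
  by move=> [k [Pk hr]]; rewrite (hak k) // lee_fin.
have pH : polyhedral H.
  rewrite eH; apply: polyhedral_convex_bigcup; last first.
    by rewrite -eH; exact: convex_hypograph.
  move=> k; apply: polyhedralI.
    have lfst : linear (fst : 'cV[R]_d * R^o -> _) by [].
    by apply: (polyhedral_preimage lfst); apply/polyhedronE; exact: (hP k).1.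
  have lk : linform (fun z : 'cV[R]_d * R^o => ((ak k).1 *m z.1) 0 0 - z.2).
    by move=> t x y /=; rewrite linform_row /GRing.scale /=; ring.
  apply: eq_polyhedral (polyhedral_halfspace (- (ak k).2) lk) => z /=.
  by rewrite /affine_form; split; lra.
have HD x : effective_domain f x <-> exists r, H (x, r).
  split=> [/effective_domain_fin [//|r er]|[r hr]].
    by exists r; rewrite /H /= er.
  by apply: lt_le_trans hr; exact: ltNyr.
case: pH => I [g [b [lg eHg]]].
pose al i := g i (0, 1); pose gx i x := g i (x, 0).
have gE i x r : g i (x, r) = gx i x + r * al i.
  rewrite /gx /al -(linformZ _ _ (lg i)) -(linformD _ _ (lg i)).
  congr (g i _); congr pair; rewrite /= ?scaler0 ?addr0 //.
  by rewrite add0r /GRing.scale /= mulr1.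
have HE x r : H (x, r) <-> forall i, b i <= gx i x + r * al i.
  by rewrite eHg /=; split=> h i; have := h i; rewrite gE.
have lgx i : linform (gx i).
  move=> t x y; rewrite /gx -(linformZ _ _ (lg i)) -(linformD _ _ (lg i)).
  by congr (g i _); congr pair; rewrite /= scaler0 addr0.
(* The hypograph contains the whole downward ray from [(x0, r0)], so a positive coefficient would be
   violated far enough down; the [- 1] in [r] makes the violation strict. *)
have al0 i : al i <= 0.
  rewrite leNgt; apply/negP => ai.
  have [r0 hr0] := (HD x0).1 Dx0.
  pose r := Num.min r0 ((b i - gx i x0) / al i - 1).
  have : H (x0, r).
    by apply: le_trans hr0; rewrite /= lee_fin ge_min lexx.
  move/HE => /(_ i); apply/negP; rewrite -ltNge.
  have : r <= (b i - gx i x0) / al i - 1 by rewrite ge_min lexx orbT.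
  by rewrite lerBrDr ler_pdivlMr //; lra.
pose J := {i : I | al i < 0}.
have ha (j : J) : exists a : 'rV[R]_d, forall x, - gx (val j) x / al (val j) = (a *m x) 0 0.
  by apply: (@linform_rowP _ _ (fun x => - gx (val j) x / al (val j))) => t x y;
    rewrite lgx; ring.
pose a j := projT1 (cid (ha j)); have haE j := projT2 (cid (ha j)).
pose c (j : J) := b (val j) / al (val j).
have LE (j : J) x r : (b (val j) <= gx (val j) x + r * al (val j)) <->
    (r <= affine_form (a j) (c j) x).
  have aj : al (val j) < 0 := valP j.
  rewrite /affine_form -haE /c -mulrDl ler_ndivlMr //.
  by split; lra.
have H2 x r : H (x, r) <-> (forall i, al i = 0 -> b i <= gx i x) /\
    (forall j : J, r <= affine_form (a j) (c j) x).
  rewrite HE; split=> [h|[h1 h2] i].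
    split=> [i ai|j]; first by have := h i; rewrite ai mulr0 addr0.
    by apply/LE.
  have := al0 i; rewrite le_eqVlt => /predU1P[ai|ai].
    by rewrite ai mulr0 addr0; exact: h1.
  by apply/(LE (exist _ i ai)).
have fle j x : (f x <= (affine_form (a j) (c j) x)%:E)%E.
  case E : (f x) => [r||]; [|by have := fy x; rewrite E|exact: leNye].
  have : H (x, r) by rewrite /H /= E.
  by move/H2 => [_ /(_ j)]; rewrite lee_fin.
(* The inequalities free of the last coordinate cut out the domain. If [f x] were below every form,
   the hypograph would contain a point strictly above [f x]. *)
have fex x : (forall i, al i = 0 -> b i <= gx i x) ->
    exists j, f x = (affine_form (a j) (c j) x)%:E.
  move=> hx.
  have [r hr] : exists r, f x = r%:E.
    apply: effective_domain_fin => //; apply/HD.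
    (* With no lower bounds, this yields a [t] below all the forms, so [(x, t)] lies in the
       hypograph and [f x] is finite. *)
    have [|t [_ ht]] := @between_families R void J (fun=> 0)
      (fun j => affine_form (a j) (c j) x) xpredT xpredT; first by case.
    by exists t; apply/H2; split=> // j; exact: ht.
  apply: contrapT => /forallNP hn.
  have [e e0 he] : exists2 e, 0 < e &
      forall (j : J) s, 0 < s -> s <= e -> r + s <= affine_form (a j) (c j) x.
    apply: finite_min_pos => j; exists (affine_form (a j) (c j) x - r).
      rewrite subr_gt0 lt_def -lee_fin -hr fle andbT; apply/eqP => E.
      by apply: (hn j); rewrite hr E.
    by move=> s _; lra.
  have : H (x, r + e) by apply/H2; split=> // j; exact: he.
  by rewrite /H /= hr lee_fin; lra.
exists J, a, c; split=> // [j|x].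
  (* The piece of [j] consists of the points of the domain at which form [j] is least. *)
  apply: (@eq_polyhedral R _ ([set x | forall i, al i = 0 -> b i <= gx i x] `&`
     [set x | forall i, c j - c i <= ((a i - a j) *m x) 0 0])).
    move=> x; split=> /= [[h1 h2]|E].
      have [i Ei] := fex x h1; apply/eqP; rewrite eq_le fle /= Ei lee_fin.
      by have := h2 i; rewrite mulmxBl !mxE /affine_form !mxE; lra.
    split=> [|i]; last first.
      have := fle i x; rewrite E lee_fin.
      by rewrite mulmxBl !mxE /affine_form !mxE; lra.
    by have /H2[] : H (x, affine_form (a j) (c j) x) by rewrite /H /= E.
  apply: polyhedralI.
    by apply: polyhedral_bigcap => i; apply/polyhedral_cond/polyhedral_halfspace.
  by apply: polyhedral_bigcap => i; apply/polyhedral_halfspace/linform_row.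
by move=> /HD [r /H2 [h _]]; exact: fex.
Qed.

End Pieces.

(** * Regions of linearity *)

Section Regions.
Context {R : realType} {d : nat}.
Context (f : 'cV[R]_d -> \bar R).
Context (J : finType) (a : J -> 'rV[R]_d) (c : J -> R).
Context (ppiece : forall j, polyhedral (piece f (a j) (c j))).
Context (fle : forall j x, (f x <= (affine_form (a j) (c j) x)%:E)%E).
Context (fex : forall x, effective_domain f x -> exists j, piece f (a j) (c j) x).

(* Otherwise each form exceeds [f] somewhere on [P]; [f] being affine on [P],
   averaging these points gives a point where all the forms exceed [f]. *)
Lemma affine_on_sub_piece P : convex P -> affine_on f P -> P !=set0 ->
  exists j, P `<=` piece f (a j) (c j).
Proof.
move=> cP [b [e hP]] [x0 Px0].
apply: contrapT => /forallNP hn.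
have hx j : exists2 x, P x & affine_form b e x < affine_form (a j) (c j) x.
  apply: contrapT => hj; apply: (hn j) => x Px; rewrite /piece /= (hP x Px).
  congr (_%:E); apply/eqP; rewrite eq_le -lee_fin -[X in (X <= _)%E](hP x Px) fle /=.
  by rewrite leNgt; apply/negP => lt; apply: hj; exists x.
have : exists2 x, P x & forall j, j \in enum J ->
    affine_form b e x < affine_form (a j) (c j) x.
  elim: (enum J) => [|j s [x Px IH]]; first by exists x0.
  have [y Py hy] := hx j.
  have hle z i : P z -> affine_form b e z <= affine_form (a i) (c i) z.
    by move=> Pz; rewrite -lee_fin -[X in (X <= _)%E](hP z Pz) fle.
  exists (2^-1 *: x + (1 - 2^-1) *: y).
    by apply: cP => //; rewrite invr_ge0 ler0n invf_le1 ?ler1n.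
  have h2 : 0 < 2^-1 :> R by rewrite invr_gt0.
  have h2' : 1 - 2^-1 = 2^-1 :> R by field.
  move=> i; rewrite !affine_form_mix h2' inE => /predU1P[->|si].
    by have := hle x j Px; nra.
  by have := hle y i Py; have := IH i si; nra.
move=> [x Px hlt]; have [|j] := fex (x := x).
  by rewrite /effective_domain /= (hP x Px) ltNyr.
rewrite /piece /= (hP x Px) => -[E].
by have := hlt j (mem_enum _ j); rewrite /affine_form E ltxx.
Qed.

Lemma piece_affine_on j : affine_on f (piece f (a j) (c j)).
Proof. by exists (a j), (c j). Qed.

(** A region lies in some piece, which is itself a polyhedron on which [f] is affine; maximality
    forces equality. *)
Lemma region_is_piece P : region_of_linearity f P -> P !=set0 ->
  exists j, P = piece f (a j) (c j).
Proof.
move=> [pP aP maxP] P0.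
have [j Pj] := affine_on_sub_piece (polyhedral_convex ((polyhedronE P).1 pP)) aP P0.
exists j; apply/esym/maxP => //; first exact/polyhedronE/ppiece.
exact: piece_affine_on.
Qed.

(** Among the finitely many pieces containing the given one, a piece that contains the largest
    number of pieces is maximal. *)
Lemma piece_sub_region j : piece f (a j) (c j) !=set0 ->
  exists i, piece f (a j) (c j) `<=` piece f (a i) (c i) /\
    region_of_linearity f (piece f (a i) (c i)).
Proof.
set Q := fun j => piece f (a j) (c j) => Qj.
pose below i := [set k | `[< Q k `<=` Q i >] ]%SET.
have Qjj : `[< Q j `<=` Q j >] by apply/asboolP.
case: (@arg_maxnP _ j (fun i => `[< Q j `<=` Q i >]) (fun i => #|below i|) Qjj)
  => i /asboolP ji imax.
exists i; split=> //; split; first exact/polyhedronE/ppiece.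
  exact: piece_affine_on.
move=> P /polyhedronE pP aP iP.
have [|k Pk] := affine_on_sub_piece (polyhedral_convex pP) aP.
  by case: Qj => x /ji /iP; exists x.
have ik : Q i `<=` Q k by move=> x /iP /Pk.
suff : k \in below i.
  rewrite !inE => ki; apply/seteqP; split=> // x /Pk; exact: ki.
have sub : below i \subset below k.
  apply/fintype.subsetP => l; rewrite !inE => li.
  exact: subset_trans li ik.
have /eqP -> : below i == below k.
  rewrite eqEcard sub; apply: imax; apply/asboolP => x /ji /ik; exact.
by rewrite !inE.
Qed.

End Regions.

(** * Min-max closed sets, their faces, and contact sets of supermodular functions *)

Section MinMax.
Context {R : realType} {d : nat}.
Implicit Types (x y : 'cV[R]_d) (P : set 'cV[R]_d).

Lemma vminE x y i : vmin x y i 0 = Num.min (x i 0) (y i 0).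
Proof. by rewrite mxE. Qed.

Lemma vmaxE x y i : vmax x y i 0 = Num.max (x i 0) (y i 0).
Proof. by rewrite mxE. Qed.

Lemma vmin_add_vmax x y : vmin x y + vmax x y = x + y.
Proof. by apply/colP => i; rewrite [in LHS]mxE vminE vmaxE addr_min_max mxE. Qed.

Lemma linform_min_max (g : 'cV[R]_d -> R) x y : linform g ->
  g (vmin x y) + g (vmax x y) = g x + g y.
Proof. by move=> lg; rewrite -!linformD // vmin_add_vmax. Qed.

(** The values of the form at the minimum and the maximum are at least [b] and add up to [2 b], so
    both equal [b]. *)
Lemma face_minmax_closed C P : face C P -> minmax_closed P -> minmax_closed C.
Proof.
move=> [a [b [hP ->]]] mP u v [Pu /= hu] [Pv /= hv].
have [Pm PM] := mP u v Pu Pv.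
have := hP _ Pm; have := hP _ PM.
have := linform_min_max u v (linform_row a); rewrite hu hv => e h1 h2.
by split; split=> //=; lra.
Qed.

Lemma supermodular_piece (f : 'cV[R]_d -> \bar R) a c :
  supermodular f -> (forall x, (f x <= (affine_form a c x)%:E)%E) ->
  minmax_closed (piece f a c).
Proof.
move=> sf fle u v; rewrite /piece /= => hu hv.
have := sf u v; rewrite hu hv.
have := fle (vmin u v); have := fle (vmax u v).
(* Infinite values are excluded: [+oo] by the upper bound [fle], [-oo] because supermodularity
   bounds the sum below by a real number. *)
case: (f (vmin u v)) => [r||]; case: (f (vmax u v)) => [s||] //=.
rewrite !lee_fin /affine_form.
have := linform_min_max u v (linform_row a) => e h1 h2 h3.
by split; congr (_%:E); lra.
Qed.

End MinMax.

(** * Additive arguments on the unit square *)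

Section UnitSquare.
Context {R : realType}.

(** Cousin's covering argument. At the supremum [s] of the points [x] with [G 0 x], the left half of
    the local condition gives [G 0 s], and the right half leads beyond [s] unless [s = 1]. *)
Lemma cousin_unit_interval (G : R -> R -> Prop) :
  (forall a b c, a <= b -> b <= c -> G a b -> G b c -> G a c) ->
  (forall z, 0 <= z <= 1 -> exists2 r : R, 0 < r &
     (forall a, 0 <= a -> z - r <= a <= z -> G a z) /\
     (forall b, b <= 1 -> z <= b <= z + r -> G z b)) ->
  G 0 1.
Proof.
move=> Gadd Gloc.
pose S := [set x : R | 0 <= x <= 1 /\ G 0 x].
have S0 : S 0.
  split; first by rewrite lexx ler01.
  have [|r r0 [h _]] := Gloc 0; first by rewrite lexx ler01.
  by apply: h; rewrite ?lexx // andbT; lra.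
have ubS : ubound S 1 by move=> x [/andP[]].
have supS : has_sup S by split; [exists 0 | exists 1].
set s := sup S.
have s0 : 0 <= s by apply: ub_le_sup => //; exists 1.
have s1 : s <= 1 by apply: ge_sup => //; exists 0.
have [|r r0 [hl hr]] := Gloc s; first by rewrite s0.
have [x [/andP[x0 x1] Gx] sx] := sup_adherent r0 supS.
have xs : x <= s by apply: ub_le_sup => //; [exists 1 | split=> //; rewrite x0].
have Gs : G 0 s.
  by apply: Gadd Gx (hl _ _ _) => //; rewrite xs andbT ltW.
pose b := Num.min 1 (s + r).
have b1 : b <= 1 by rewrite ge_min lexx.
have sb : s <= b by rewrite le_min s1 /= lerDl ltW.
have Gb : G 0 b.
  by apply: Gadd Gs (hr _ b1 _) => //; rewrite sb ge_min lexx orbT.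
have bs : b <= s.
  by apply: ub_le_sup; [exists 1 | split=> //; rewrite b1 (le_trans s0)].
have : b = 1.
  move: bs; rewrite /b ge_min => /orP[h|]; last by lra.
  by apply/min_idPl; lra.
by move=> <-.
Qed.

(** The inequality is additive when a rectangle is cut in two, so the covering argument applies
    twice: along the first variable it gives all rectangles of full width in a thin strip around a
    height [t], and along the second it stacks the strips. Joining parts shrinks the strip, hence
    the [r] bound inside the inner [G]. *)
Lemma unit_square_submodular (h : R -> R -> R) :
  (forall s t, 0 <= s <= 1 -> 0 <= t <= 1 -> exists2 r : R, 0 < r &
     forall s' t', 0 <= s' <= 1 -> 0 <= t' <= 1 ->
       `|s' - s| <= r -> `|t' - t| <= r ->
       (0 <= (s' - s) * (t' - t) -> h s t + h s' t' <= h s' t + h s t') /\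
       ((s' - s) * (t' - t) <= 0 -> h s' t + h s t' <= h s t + h s' t')) ->
  h 0 0 + h 1 1 <= h 1 0 + h 0 1.
Proof.
move=> hloc.
apply: (cousin_unit_interval (G := fun u v => h 0 u + h 1 v <= h 1 u + h 0 v)).
  by move=> u v w _ _; lra.
move=> t t01.
have [r r0 hr] : exists2 r : R, 0 < r & forall u v, 0 <= u -> v <= 1 ->
    t - r <= u <= t -> t <= v <= t + r -> h 0 u + h 1 v <= h 1 u + h 0 v.
  apply: (cousin_unit_interval (G := fun a b => exists2 r : R, 0 < r &
      forall u v, 0 <= u -> v <= 1 ->
      t - r <= u <= t -> t <= v <= t + r -> h a u + h b v <= h b u + h a v)).
    move=> a b c _ _ [r r0 hr] [r' r'0 hr'].
    exists (Num.min r r'); first by rewrite lt_min r0.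
    move=> u v u0 v1 /andP[h1 h2] /andP[h3 h4].
    have m1 : Num.min r r' <= r by rewrite ge_min lexx.
    have m2 : Num.min r r' <= r' by rewrite ge_min lexx orbT.
    have := hr u v u0 v1; have := hr' u v u0 v1.
    rewrite h2 h3 !andbT /=.
    have -> : t - r <= u by lra.
    have -> : t - r' <= u by lra.
    have -> : v <= t + r by lra.
    have -> : v <= t + r' by lra.
    by move=> /(_ isT isT) + /(_ isT isT); lra.
  move=> s s01; have [r r0 hr] := hloc s t s01 t01.
  (* Cutting at height [t] splits the rectangle into two that have [(s, t)] as a corner, one for
     each sign in the hypothesis. *)
  have aux s' u v : 0 <= s' <= 1 -> `|s' - s| <= r -> 0 <= u -> v <= 1 ->
     t - r <= u <= t -> t <= v <= t + r ->
     (s' <= s -> h s' u + h s v <= h s u + h s' v) /\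
     (s <= s' -> h s u + h s' v <= h s' u + h s v).
    move=> s'01 ss' u0 v1 /andP[h1 h2] /andP[h3 h4].
    have [t0 t1] := andP t01.
    have u01 : 0 <= u <= 1 by rewrite u0 /=; lra.
    have v01 : 0 <= v <= 1 by rewrite v1 andbT; lra.
    have du : `|u - t| <= r by rewrite ler_norml; apply/andP; split; lra.
    have dv : `|v - t| <= r by rewrite ler_norml; apply/andP; split; lra.
    have [e1 e2] := hr s' u s'01 u01 ss' du.
    have [e3 e4] := hr s' v s'01 v01 ss' dv.
    split=> le.
      have := e1 _; have := e4 _; rewrite mulr_le0_ge0 ?mulr_le0 ?subr_le0 ?subr_ge0 //.
      by move=> /(_ isT) + /(_ isT); lra.
    have := e2 _; have := e3 _; rewrite mulr_ge0_le0 ?mulr_ge0 ?subr_le0 ?subr_ge0 //.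
    by move=> /(_ isT) + /(_ isT); lra.
  have [s0 s1] := andP s01.
  exists r => //; split=> [a a0 /andP[a1 a2]|b b1 /andP[b1' b2]];
    exists r => // u v u0 v1 hu hv.
    have a01 : 0 <= a <= 1 by rewrite a0 /=; lra.
    have as_r : `|a - s| <= r by rewrite ler_norml; apply/andP; split; lra.
    by have [e _] := aux a u v a01 as_r u0 v1 hu hv; exact: e.
  have b01 : 0 <= b <= 1 by rewrite b1 andbT; lra.
  have bs_r : `|b - s| <= r by rewrite ler_norml; apply/andP; split; lra.
  by have [_ e] := aux b u v b01 bs_r u0 v1 hu hv; exact: e.
have [t0 t1] := andP t01.
exists r => //; split=> [u u0 u1|v v1 v2]; apply: hr => //; rewrite lexx ?andbT //=; lra.
Qed.

(* Look at the last point [(w, 1 - w)] of [E] on the way to [(1, 0)].  If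
   [w < 1], moving from it towards [(1, 1)] and towards [(0, 0)] and exchanging
   coordinates gives points of [E] to its right and below it, and their midpoint
   is further on the way. *)
Lemma unit_square_corner (E : R -> R -> Prop) :
  (forall l s t s' t' : R, 0 <= l <= 1 -> E s t -> E s' t' ->
     E (l * s + (1 - l) * s') (l * t + (1 - l) * t')) ->
  (forall s t, ~ E s t -> exists2 r : R, 0 < r &
     forall s' t', `|s' - s| <= r -> `|t' - t| <= r -> ~ E s' t') ->
  (forall s t, E s t -> exists2 r : R, 0 < r &
     forall s' t', `|s' - s| <= r -> `|t' - t| <= r -> E s' t' ->
       0 <= (s' - s) * (t' - t) -> E s' t /\ E s t') ->
  E 0 0 -> E 1 1 -> E 1 0.
Proof.
move=> cE clE lE E0 E1.
pose S := [set w : R | 0 <= w <= 1 /\ E w (1 - w)].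
have eqE s t s' t' : s = s' -> t = t' -> E s t -> E s' t' by move=> -> ->.
have h2 : 0 <= (2^-1 : R) <= 1 by rewrite invr_ge0 ler0n invf_le1 ?ler1n.
have mid s t s' t' : E s t -> E s' t' -> E ((s + s') / 2) ((t + t') / 2).
  by move=> e e'; apply: eqE (cE _ _ _ _ _ h2 e e'); field.
have S2 : S 2^-1.
  by split=> //; apply: eqE (mid _ _ _ _ E0 E1); field.
have ubS : ubound S 1 by move=> x [/andP[]].
have supS : has_sup S by split; [exists 2^-1 | exists 1].
set w := sup S.
have w0 : 0 < w.
  by apply: (@lt_le_trans _ _ 2^-1); [rewrite invr_gt0 | apply: ub_le_sup => //; exists 1].
have w1 : w <= 1 by apply: ge_sup => //; exists 2^-1.
have Ew : E w (1 - w).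
  apply: contrapT => /clE [r r0 hr].
  have [x [x01 Ex] wx] := sup_adherent r0 supS.
  rewrite -/w in wx.
  have xw : x <= w by apply: ub_le_sup => //; exists 1.
  by apply: (hr x (1 - x)) => //; rewrite ler_norml; apply/andP; split; lra.
move: w1; rewrite le_eqVlt => /predU1P[e|w1]; first by move: Ew; rewrite e subrr.
have [r r0 hr] := lE _ _ Ew.
(* The bound by [r] keeps the moved points near [(w, 1 - w)], and the bound by 1 makes [e] a convex
   weight. *)
pose e := Num.min r 1.
have e0 : 0 < e by rewrite lt_min r0 ltr01.
have e1 : e <= 1 by rewrite ge_min lexx orbT.
have er : e <= r by rewrite ge_min lexx.
have e01 : 0 <= 1 - e <= 1 by apply/andP; split; lra.
have [Er _] : E (w + e * (1 - w)) (1 - w) /\ E w (1 - w + e * w).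
  apply: hr; rewrite ?ler_norml; [apply/andP; split; nra|apply/andP; split; nra| |].
    by apply: eqE (cE _ _ _ _ _ e01 Ew E1); ring.
  by nra.
have [_ El] : E (w - e * w) (1 - w) /\ E w (1 - w - e * (1 - w)).
  apply: hr; rewrite ?ler_norml; [apply/andP; split; nra|apply/andP; split; nra| |].
    by apply: eqE (cE _ _ _ _ _ e01 Ew E0); ring.
  by nra.
have Sw : S (w + e * (1 - w) / 2).
  split; first by apply/andP; split; nra.
  by apply: eqE (mid _ _ _ _ Er El); field.
have : w + e * (1 - w) / 2 <= w by apply: ub_le_sup => //; exists 1.
by nra.
Qed.

End UnitSquare.

(** * Supermodularity from min-max closed pieces *)

Section Supermodular.
Context {R : realType} {d : nat}.

(** Parametrises the rectangle with diagonal from [x] to [y]: [s] lowers the coordinates where [x]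
    exceeds [y], and [t] raises the others. *)
Definition minmax_point (x y : 'cV[R]_d) (s t : R) : 'cV[R]_d :=
  x + s *: (vmin x y - x) + t *: (vmax x y - x).

Lemma minmax_pointE x y s t i : minmax_point x y s t i 0 =
  if x i 0 <= y i 0 then x i 0 + t * (y i 0 - x i 0)
  else x i 0 + s * (y i 0 - x i 0).
Proof. by rewrite !mxE; case: leP => _; ring. Qed.

Lemma minmax_point00 x y : minmax_point x y 0 0 = x.
Proof. by rewrite /minmax_point !scale0r !addr0. Qed.

Lemma minmax_point10 x y : minmax_point x y 1 0 = vmin x y.
Proof. by rewrite /minmax_point scale1r scale0r addr0 addrC subrK. Qed.

Lemma minmax_point01 x y : minmax_point x y 0 1 = vmax x y.
Proof. by rewrite /minmax_point scale1r scale0r addr0 addrC subrK. Qed.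

Lemma minmax_point11 x y : minmax_point x y 1 1 = y.
Proof.
by apply/colP => i; rewrite minmax_pointE; case: ifP => _; rewrite mul1r addrC subrK.
Qed.

Lemma minmax_point_shift x y s t s' t' : minmax_point x y s' t' =
  minmax_point x y s t + (s' - s) *: (vmin x y - x) + (t' - t) *: (vmax x y - x).
Proof. by apply/colP => i; rewrite !mxE; ring. Qed.

Lemma minmax_point_mix x y l s t s' t' :
  minmax_point x y (l * s + (1 - l) * s') (l * t + (1 - l) * t') =
  l *: minmax_point x y s t + (1 - l) *: minmax_point x y s' t'.
Proof. by apply/colP => i; rewrite !mxE; ring. Qed.

(** Coordinates decrease in [s] and increase in [t]. Hence two points opposite on an increasing
    diagonal have the other two corners as their minimum and maximum. *)
Lemma minmax_point_closed P x y s t s' t' : minmax_closed P ->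
  P (minmax_point x y s t) -> P (minmax_point x y s' t') ->
  0 <= (s' - s) * (t' - t) ->
  P (minmax_point x y s' t) /\ P (minmax_point x y s t').
Proof.
move=> mP.
have key s1 t1 s2 t2 : P (minmax_point x y s1 t1) -> P (minmax_point x y s2 t2) ->
    s1 <= s2 -> t1 <= t2 ->
    P (minmax_point x y s2 t1) /\ P (minmax_point x y s1 t2).
  move=> h1 h2 s12 t12; have [] := mP _ _ h1 h2.
  have -> : vmin (minmax_point x y s1 t1) (minmax_point x y s2 t2) =
      minmax_point x y s2 t1.
    apply/colP => i; rewrite vminE !minmax_pointE; case: leP => xy.
      by apply/min_idPl; nra.
    by apply/min_idPr; nra.
  have -> : vmax (minmax_point x y s1 t1) (minmax_point x y s2 t2) =
      minmax_point x y s1 t2.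
    apply/colP => i; rewrite vmaxE !minmax_pointE; case: leP => xy.
      by apply/max_idPr; nra.
    by apply/max_idPl; nra.
  by [].
move=> h1 h2 p.
have [[ss tt]|[ss tt]] : s <= s' /\ t <= t' \/ s' <= s /\ t' <= t.
  case: (leP s s') => a; case: (leP t t') => b; [by left|right|right|right].
  - by split; [rewrite leNgt; apply/negP; nra | exact: ltW].
  - by split; [exact: ltW | rewrite leNgt; apply/negP; nra].
  - by split; exact: ltW.
  exact: key h1 h2 ss tt.
by have [? ?] := key _ _ _ _ h2 h1 ss tt.
Qed.

Context (f : 'cV[R]_d -> \bar R).
Context (fy : forall x, f x != +oo%E) (cf : concave f).
(** Real-valued version of [f], meaningful on the domain only: [fine] sends [-oo] to 0. *)
Let F x : R := fine (f x).

Lemma effective_domain_fineE x : effective_domain f x -> f x = (F x)%:E.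
Proof. by move=> /(effective_domain_fin (fy x)) [r hr]; rewrite /F hr. Qed.

Lemma concave_fine x y t : 0 <= t <= 1 -> effective_domain f x ->
  effective_domain f y ->
  effective_domain f (t *: x + (1 - t) *: y) /\
  t * F x + (1 - t) * F y <= F (t *: x + (1 - t) *: y).
Proof.
move=> t01 Dx Dy; have := cf x y t01.
rewrite (effective_domain_fineE Dx) (effective_domain_fineE Dy) -!EFinM -EFinD => h.
have D : effective_domain f (t *: x + (1 - t) *: y).
  by apply: lt_le_trans h; exact: ltNyr.
by split=> //; rewrite -lee_fin -(effective_domain_fineE D).
Qed.

Context (J : finType) (K : J -> set 'cV[R]_d).
Context (pK : forall j, polyhedral (K j)) (mK : forall j, minmax_closed (K j)).
Context (aK : forall j, affine_on f (K j)).
Context (cK : forall x, effective_domain f x -> exists j, K j x).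

Lemma pieces_sub_domain j x : K j x -> effective_domain f x.
Proof.
have [a [c h]] := aK j; move=> /h E.
by rewrite /effective_domain /= E ltNyr.
Qed.

(** The finitely many pieces that miss [z] also miss all nearby points, so any piece containing a
    nearby point contains [z]. *)
Lemma near_common_piece z p q : exists2 r : R, 0 < r &
  forall a b, `|a| <= r -> `|b| <= r -> effective_domain f (z + a *: p + b *: q) ->
  exists j, K j z /\ K j (z + a *: p + b *: q).
Proof.
have [r r0 hr] : exists2 r : R, 0 < r & forall j r', 0 < r' -> r' <= r ->
    forall a b, `|a| <= r' -> `|b| <= r' -> K j (z + a *: p + b *: q) -> K j z.
  apply: finite_min_pos => j.
  have [Kz|nKz] := pselect (K j z); first by exists 1.
  have [r r0 hr] := polyhedral_open_compl p q (pK j) nKz.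
  exists r => // r' r'0 rr' a b ha hb.
  by move/(hr a b (le_trans ha rr') (le_trans hb rr')).
exists r => // a b ha hb /cK [j Kj]; exists j; split=> //.
exact: (hr j r r0 (lexx r) a b ha hb Kj).
Qed.

Section Pair.
Context (x y : 'cV[R]_d).
Context (Dx : effective_domain f x) (Dy : effective_domain f y).
Local Notation z := (minmax_point x y).
Let E s t := effective_domain f (z s t).

Lemma near_common_piece_minmax s t : exists2 r : R, 0 < r &
  forall s' t', `|s' - s| <= r -> `|t' - t| <= r -> E s' t' ->
  exists j, K j (z s t) /\ K j (z s' t').
Proof.
have [r r0 hr] := near_common_piece (z s t) (vmin x y - x) (vmax x y - x).
exists r => // s' t' hs ht; rewrite /E (minmax_point_shift _ _ s t s' t').
exact: hr.
Qed.

Lemma mix_mem l s t s' t' : 0 <= l <= 1 -> E s t -> E s' t' ->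
  E (l * s + (1 - l) * s') (l * t + (1 - l) * t').
Proof. by move=> l01 h h'; rewrite /E minmax_point_mix; exact: (concave_fine l01 h h').1. Qed.

Lemma domain_closed s t : ~ E s t -> exists2 r : R, 0 < r &
  forall s' t', `|s' - s| <= r -> `|t' - t| <= r -> ~ E s' t'.
Proof.
move=> nE; have [r r0 hr] := near_common_piece_minmax s t.
exists r => // s' t' hs ht e; apply: nE.
by have [j [Kj _]] := hr s' t' hs ht e; exact: pieces_sub_domain Kj.
Qed.

Lemma domain_exchange s t : E s t -> exists2 r : R, 0 < r &
  forall s' t', `|s' - s| <= r -> `|t' - t| <= r -> E s' t' ->
    0 <= (s' - s) * (t' - t) -> E s' t /\ E s t'.
Proof.
move=> e; have [r r0 hr] := near_common_piece_minmax s t.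
exists r => // s' t' hs ht e' p.
have [j [h1 h2]] := hr s' t' hs ht e'.
have [h3 h4] := minmax_point_closed (@mK j) h1 h2 p.
by split; [exact: pieces_sub_domain h3 | exact: pieces_sub_domain h4].
Qed.

(** The corner argument gives [(1, 0)] and, with the coordinates exchanged, [(0, 1)]; convexity
    fills in the square. *)
Lemma domain_unit_square s t : 0 <= s <= 1 -> 0 <= t <= 1 -> E s t.
Proof.
move=> s01 t01.
have E00 : E 0 0 by rewrite /E minmax_point00.
have E11 : E 1 1 by rewrite /E minmax_point11.
have E10 : E 1 0.
  exact: (unit_square_corner mix_mem domain_closed domain_exchange).
have E01 : E 0 1.
  apply: (unit_square_corner (E := fun s t => E t s)) => //.
  - by move=> *; exact: mix_mem.
  - move=> u v /domain_closed [r r0 hr]; exists r => // u' v' hu hv; exact: hr.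
  - move=> u v /domain_exchange [r r0 hr]; exists r => // u' v' hu hv e.
    by rewrite mulrC => /(hr v' u' hv hu e) [].
have := mix_mem t01 (mix_mem s01 E11 E01) (mix_mem s01 E10 E00).
by congr (E _ _); ring.
Qed.

Lemma supermodular_pair : F x + F y <= F (vmin x y) + F (vmax x y).
Proof.
have := @unit_square_submodular R (fun s t => F (z s t)).
rewrite minmax_point00 minmax_point01 minmax_point10 minmax_point11; apply.
move=> s t s01 t01.
have [r r0 hr] := near_common_piece_minmax s t.
exists r => // s' t' s'01 t'01 hs ht.
have [j [h1 h2]] := hr s' t' hs ht (domain_unit_square s'01 t'01).
have [a [c hK]] := aK j.
have FK u : K j u -> F u = affine_form a c u by move=> /hK; rewrite /F => ->.
split=> p.
  (* All four corners lie in [K j], where [f] is affine, so equality holds. *)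
  have [h3 h4] := minmax_point_closed (@mK j) h1 h2 p.
  rewrite !FK // /affine_form /minmax_point.
  by rewrite !(linformD _ _ (linform_row a)) !(linformZ _ _ (linform_row a)); lra.
have h01 : 0 <= (2^-1 : R) <= 1 by rewrite invr_ge0 ler0n invf_le1 ?ler1n.
(* [z s t] and [z s' t'] lie in the same piece, so at their midpoint, which is
   also that of [z s' t] and [z s t'], [f] takes the average value. *)
have Km := polyhedral_convex (pK j) h01 h1 h2.
have [_] := concave_fine h01 (domain_unit_square s'01 t01) (domain_unit_square s01 t'01).
have -> : 2^-1 *: z s' t + (1 - 2^-1) *: z s t' = 2^-1 *: z s t + (1 - 2^-1) *: z s' t'.
  by apply/colP => i; rewrite !mxE; field.
by rewrite (FK _ Km) affine_form_mix -!FK //; lra.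
Qed.

End Pair.

Lemma supermodular_of_pieces : supermodular f.
Proof.
move=> x y.
have [Dx|] := pselect (effective_domain f x); last first.
  by rewrite /effective_domain /= ltNye => /negP; rewrite negbK => /eqP ->;
    rewrite addNye leNye.
have [Dy|] := pselect (effective_domain f y); last first.
  by rewrite /effective_domain /= ltNye => /negP; rewrite negbK => /eqP ->;
    rewrite addeNy leNye.
have i01 : 0 <= (0 : R) <= 1 by rewrite lexx ler01.
have i11 : 0 <= (1 : R) <= 1 by rewrite lexx ler01.
have := domain_unit_square Dx Dy i11 i01; rewrite minmax_point10 => Dm.
have := domain_unit_square Dx Dy i01 i11; rewrite minmax_point01 => DM.
rewrite (effective_domain_fineE Dx) (effective_domain_fineE Dy).
rewrite (effective_domain_fineE Dm) (effective_domain_fineE DM) -!EFinD lee_fin.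
exact: supermodular_pair.
Qed.

End Supermodular.

(** * Bimonotone descriptions *)

Section Inequalities.
Context {R : realType}.

Lemma mulr_le0_cases (u v : R) : u * v <= 0 ->
  u <= 0 /\ 0 <= v \/ 0 <= u /\ v <= 0.
Proof.
move=> uv; case: (ltP 0 u) => u0.
  by right; split; [exact: ltW | nra].
case: (leP 0 v) => v0; first by left.
by right; split; [nra | exact: ltW].
Qed.

(* Decoupling: [z] shows that [c <= al * u x + be * v y] for all [x], [y]. *)
Lemma inequality_box (T : Type) (X : set T) (u v : T -> R) (al be c : R) :
  0 < al -> 0 < be -> X !=set0 ->
  (forall x y : T, X x -> X y -> exists2 z, X z & u z <= u x /\ v z <= v y) ->
  (forall x : T, X x -> c <= al * u x + be * v x) ->
  exists m n, (forall x : T, X x -> m <= u x /\ n <= v x) /\ c <= al * m + be * n.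
Proof.
move=> al0 be0 [x0 Xx0] hX hc.
have key x y : X x -> X y -> (c - be * v y) / al <= u x.
  move=> Xx Xy; have [z Xz [zu zv]] := hX x y Xx Xy.
  by rewrite ler_pdivrMr //; have := hc z Xz; nra.
pose m := inf [set u x | x in X].
(* The second bound is the one for which [al * m + be * n] equals [c]; it holds because, by [key],
   every [(c - be * v x) / al] is a lower bound of [u] on [X]. *)
exists m, ((c - al * m) / be); split; last by rewrite [be * _]mulrC divfK ?gt_eqF //; lra.
move=> x Xx; split.
  by apply: ge_inf; [exists ((c - be * v x0) / al) => _ [y Xy <-]; exact: key | exists x].
rewrite ler_pdivrMr //.
have : (c - be * v x) / al <= m.
  by apply: lb_le_inf; [exists (u x), x | move=> _ [y Xy <-]; exact: key].
by rewrite ler_pdivrMr //; lra.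
Qed.

End Inequalities.

Section Bimonotone.
Context {R : realType} {d : nat}.
Implicit Types (a : 'rV[R]_d) (x y : 'cV[R]_d) (S C : set 'cV[R]_d).

Definition bimonotone_form (g : 'cV[R]_d -> R) : Prop :=
  exists2 a, bimonotone a & g = (fun x => (a *m x) 0 0).

Lemma bimonotone_polyhedronE C :
  bimonotone_polyhedron C <-> cut_out bimonotone_form C.
Proof.
split=> [/solution_setP [I [a [c [ha ->]]]]|[I [g [c [hg ->]]]]].
  by exists I, (fun i x => (a i *m x) 0 0), c; split=> // i; exists (a i).
have hg' i : exists a, bimonotone a /\ forall x, g i x = (a *m x) 0 0.
  by have [a ? ->] := hg i; exists a.
apply/solution_setP; exists I, (fun i => projT1 (cid (hg' i))), c.
split=> [i|]; first exact: (projT2 (cid (hg' i))).1.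
by apply/seteqP; split=> x /= h i; have := h i; rewrite (projT2 (cid (hg' i))).2.
Qed.

Lemma mulmx_support2 a x i j : i != j ->
  (forall k, k != i -> k != j -> a 0 k = 0) ->
  (a *m x) 0 0 = a 0 i * x i 0 + a 0 j * x j 0.
Proof.
move=> ij ha; rewrite mxE (bigD1 i) //= (bigD1 j) /= 1?eq_sym //.
by rewrite big1 ?addr0 // => k /andP[ki kj]; rewrite ha ?mul0r.
Qed.

Lemma bimonotone_minmax_closed C : bimonotone_polyhedron C -> minmax_closed C.
Proof.
move=> /solution_setP [I [a [c [ha ->]]]] u v hu hv; split=> r;
  have [i [j [ij aij a0]]] := ha r; have := hu r; have := hv r;
  rewrite !(mulmx_support2 _ ij a0) ?vminE ?vmaxE;
  have [[p q]|[p q]] := mulr_le0_cases aij;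
  by case: (leP (u i 0) (v i 0)) => ?; case: (leP (u j 0) (v j 0)) => ?; nra.
Qed.

(** A bound on one coordinate is bimonotone with a zero coefficient at a second index [j], which has
    to exist. *)
Lemma bimonotone_delta (i j : 'I_d) (s : R) : i != j ->
  bimonotone_form (fun x => s * x i 0).
Proof.
move=> ij; exists (s *: delta_mx 0 i).
  exists i, j; split=> // [|k ki kj]; rewrite !mxE ?eqxx /=.
    by rewrite eq_sym (negbTE ij) !mulr0.
  by rewrite (negbTE ki) mulr0.
apply/funext => x; rewrite (mulmx_support2 _ ij).
  by rewrite !mxE !eqxx eq_sym (negbTE ij) mulr1 mulr0 mul0r addr0.
by move=> k ki kj; rewrite !mxE (negbTE ki) mulr0.
Qed.

(** If the product of the coefficients is at most 0, the half-space itself serves. Otherwise let [s]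
    be their common sign: minima ([s = 1]) or maxima ([s = -1]) decouple the two variables, and
    bounds on single coordinates imply the inequality. *)
Lemma bimonotone_relaxation S a c i j : i != j -> minmax_closed S -> S !=set0 ->
  (forall k, k != i -> k != j -> a 0 k = 0) ->
  (forall x, S x -> c <= (a *m x) 0 0) ->
  exists B, [/\ cut_out bimonotone_form B, S `<=` B &
                B `<=` [set x | c <= (a *m x) 0 0]].
Proof.
move=> ij mS S0 a0 hc.
have ji : j != i by rewrite eq_sym.
have E x := mulmx_support2 x ij a0.
have [aij|aij] := leP (a 0 i * a 0 j) 0.
  exists [set x | c <= (a *m x) 0 0]; split=> //.
  by apply: (cut_out_halfspace (g := fun x => (a *m x) 0 0)); exists a => //; exists i, j.
have box (s : R) : 0 < s * a 0 i -> 0 < s * a 0 j -> s * s = 1 ->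
    (forall x y, S x -> S y -> exists2 z, S z &
       s * z i 0 <= s * x i 0 /\ s * z j 0 <= s * y j 0) ->
    exists B, [/\ cut_out bimonotone_form B, S `<=` B &
                B `<=` [set x | c <= (a *m x) 0 0]].
  move=> si sj ss hS.
  have sE (b t : R) : s * b * (s * t) = b * t.
    by rewrite mulrACA ss mul1r.
  have [|m [n [hmn cmn]]] := inequality_box si sj S0 hS (c := c).
    by move=> x /hc; rewrite E !sE.
  exists ([set x : 'cV[R]_d | m <= s * x i 0] `&` [set x : 'cV[R]_d | n <= s * x j 0]); split.
  - apply: cut_outI.
      exact: (cut_out_halfspace _ (bimonotone_delta s ij)).
    exact: (cut_out_halfspace _ (bimonotone_delta s ji)).
  - by move=> x /hmn [].
  - move=> x [/= h1 h2]; rewrite E -(sE (a 0 i)) -(sE (a 0 j)).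
    by apply: le_trans cmn _; rewrite lerD // ler_wpM2l // ltW.
have [ai|ai] := ltP 0 (a 0 i).
  apply: (box 1); rewrite ?mul1r //; first by nra.
  move=> x y Sx Sy; exists (vmin x y); first exact: (mS _ _ Sx Sy).1.
  by rewrite !mul1r !vminE !ge_min !lexx orbT.
have {}ai : a 0 i < 0.
  by rewrite lt_neqAle ai andbT; apply/eqP => ai0; move: aij; rewrite ai0 mul0r ltxx.
apply: (box (-1)); rewrite ?mulN1r ?opprK ?oppr_gt0 //; first by nra.
move=> x y Sx Sy; exists (vmax x y); first exact: (mS _ _ Sx Sy).2.
by rewrite !mulN1r !lerN2 !vmaxE !le_max !lexx orbT.
Qed.

(** The projection of [C] to the coordinates [i] and [j], pulled back to the full space. *)
Definition cylinder C (i j : 'I_d) : set 'cV[R]_d :=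
  [set x | exists p, [/\ C p, p i 0 = x i 0 & p j 0 = x j 0]].

Lemma polyhedral_cylinder C i j : polyhedral C -> polyhedral (cylinder C i j).
Proof.
move=> pC.
pose S : set ('cV[R]_d * 'cV[R]_d) :=
  [set z : 'cV[R]_d * 'cV[R]_d | [/\ C z.2, z.2 i 0 = z.1 i 0 & z.2 j 0 = z.1 j 0]].
apply: (@eq_polyhedral R _ [set x | exists w, S (x, w)]) => //.
apply: polyhedral_exists.
have lc k (s : R) : linform (fun z : 'cV[R]_d * 'cV[R]_d => s * (z.2 k 0 - z.1 k 0)).
  by move=> t x y; rewrite /= !mxE; ring.
have lsnd : linear (snd : 'cV[R]_d * 'cV[R]_d -> _) by [].
apply: eq_polyhedral (polyhedralI (polyhedral_preimage lsnd pC) (polyhedralI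
  (polyhedralI (polyhedral_halfspace 0 (lc i 1)) (polyhedral_halfspace 0 (lc i (-1))))
  (polyhedralI (polyhedral_halfspace 0 (lc j 1)) (polyhedral_halfspace 0 (lc j (-1)))))).
move=> [x w] /=; split.
  by case=> h [[h1 h2] [h3 h4]]; split=> //=; lra.
by case=> /= h h1 h2; split=> //; split; split=> /=; lra.
Qed.

Lemma cylinder_minmax_closed C i j : minmax_closed C -> minmax_closed (cylinder C i j).
Proof.
move=> mC u v [p [Cp pi pj]] [q [Cq qi qj]].
have [Cm CM] := mC _ _ Cp Cq.
split; [exists (vmin p q)|exists (vmax p q)]; split=> //.
all: by rewrite ?vminE ?vmaxE ?pi ?pj ?qi ?qj.
Qed.

(** Each inequality of a description of the cylinder involves only the coordinates [i] and [j], so a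
    set cut out by bimonotone forms fits between the cylinder and its half-space; the intersection
    of these sets is the cylinder. *)
Lemma bimonotone_cylinder C i j : i != j -> polyhedral C -> C !=set0 ->
  minmax_closed C -> cut_out bimonotone_form (cylinder C i j).
Proof.
move=> ij pC [x0 Cx0] mC.
have S0 : cylinder C i j x0 by exists x0.
have mS : minmax_closed (cylinder C i j) by exact: cylinder_minmax_closed.
have [I [g [c [lg eS]]]] := polyhedral_cylinder i j pC.
have hB r : exists B, [/\ cut_out bimonotone_form B, cylinder C i j `<=` B &
                B `<=` [set x | c r <= g r x]].
  have [a ha] := linform_rowP (lg r).
  have gS x : cylinder C i j x -> c r <= (a *m x) 0 0.
    by rewrite eS -ha; exact.
  have [|B [h1 h2 h3]] := bimonotone_relaxation ij mS (ex_intro _ x0 S0) _ gS.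
    move=> k ki kj; apply/eqP/negPn/negP => ak.
    (* The cylinder is invariant in direction [k], and this shift of [x0] brings the form down to
       [c r - 1]. *)
    pose t := (c r - (a *m x0) 0 0 - 1) / a 0 k.
    have : cylinder C i j (x0 + t *: delta_mx k 0).
      exists x0; split=> //; rewrite !mxE eq_sym.
        by rewrite (negbTE ki) mulr0 addr0.
      by rewrite (negbTE kj) mulr0 addr0.
    move/gS; rewrite (linformD _ _ (linform_row a)) (linformZ _ _ (linform_row a)).
    rewrite -colE [col k a 0 0]mxE /t divfK //; lra.
  by exists B; split=> // x /h3 /=; rewrite ha.
suff -> : cylinder C i j = [set x | forall r, projT1 (cid (hB r)) x].
  by apply: cut_out_bigcap => r; have [] := projT2 (cid (hB r)).
apply/seteqP; split=> x /=.
  by move=> Sx r; have [_ h _] := projT2 (cid (hB r)); exact: h.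
by move=> h; rewrite eS => r /=; have [_ _ /(_ x (h r))] := projT2 (cid (hB r)).
Qed.

(* The Baker-Pixley argument: the componentwise maximum over [j] of points of
   [C] agreeing with [x] at [i] and [j] lies above [x] and agrees with it at
   [i]; then take the minimum over [i]. *)
Lemma minmax_closed_cylinders C x : (0 < d)%N -> minmax_closed C ->
  (forall i j, cylinder C i j x) -> C x.
Proof.
move=> d0 mC hC.
have above i : exists q, [/\ C q, q i 0 = x i 0 & forall j, x j 0 <= q j 0].
  suff [q [Cq qi hq]] : exists q, [/\ C q, q i 0 = x i 0 &
      forall j, j \in enum 'I_d -> x j 0 <= q j 0].
    by exists q; split=> // j; apply: hq; rewrite mem_enum.
  elim: (enum 'I_d) => [|j s [q [Cq qi hq]]].
    by have [p [Cp pi _]] := hC i i; exists p.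
  have [p [Cp pi pj]] := hC i j.
  exists (vmax p q); split; [exact: (mC _ _ Cp Cq).2 | by rewrite vmaxE pi qi maxxx |].
  move=> k; rewrite vmaxE inE le_max => /predU1P[->|/hq ->]; last by rewrite orbT.
  by rewrite pj lexx.
suff [q [Cq xq hq]] : exists q, [/\ C q, forall k, x k 0 <= q k 0 &
    forall i, i \in enum 'I_d -> q i 0 <= x i 0].
  suff -> : x = q by [].
  by apply/colP => i; apply/eqP; rewrite eq_le xq hq // mem_enum.
elim: (enum 'I_d) => [|i s [q [Cq xq hq]]].
  by have [q [Cq _ xq]] := above (Ordinal d0); exists q.
have [p [Cp pi xp]] := above i.
exists (vmin p q); split; first exact: (mC _ _ Cp Cq).1.
  by move=> k; rewrite vminE le_min xp xq.
move=> k; rewrite vminE inE ge_min => /predU1P[->|/hq ->]; last by rewrite orbT.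
by rewrite pi lexx.
Qed.

Lemma minmax_closed_bimonotone C : d <> 1%N -> polyhedral C -> C !=set0 ->
  minmax_closed C -> bimonotone_polyhedron C.
Proof.
move=> d1 pC C0 mC; apply/bimonotone_polyhedronE.
suff -> : C = [set x | forall r : {ij : 'I_d * 'I_d | ij.1 != ij.2},
    cylinder C (val r).1 (val r).2 x].
  apply: cut_out_bigcap => -[[i j] ij]; exact: bimonotone_cylinder.
apply/seteqP; split=> x /= => [Cx r|h]; first by exists x.
have hij i j : i != j -> cylinder C i j x by move=> ij; exact: (h (exist _ (i, j) ij)).
(* In dimension 0 the nonempty set [C] is the whole one-point space. *)
have [d0|d0] := posnP d.
  have [y Cy] := C0; suff -> : x = y by [].
  by apply/colP => i; exfalso; case: i => i; rewrite {1}d0.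
apply: minmax_closed_cylinders => // i j.
(* The diagonal pair [(i, i)] is handled by a pair [(i, k)] with [k] different from [i], available
   since [d] is at least 2. *)
have [<-|] := eqVneq i j; last exact: hij.
have [k ik] : exists k : 'I_d, i != k.
  have d2 : (1 < d)%N by case: (d) d0 d1 => [|[]].
  by have [i0|i0] := eqVneq (val i) 0%N; [exists (Ordinal d2)|exists (Ordinal d0)];
    rewrite -val_eqE /= ?i0.
by have [p [Cp pi _]] := hij i k ik; exists p.
Qed.

End Bimonotone.

(** * Supermodularity through cells, and the bimonotone description of cells *)

Theorem theorem5p1 (R : realType) (d : nat) (f : 'cV[R]_d -> \bar R)
    (hf : piecewise_linear_concave f) :
  (supermodular f <-> (forall C : set 'cV[R]_d, cell f C -> minmax_closed C)) /\
  (d <> 1%N ->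
   forall C : set 'cV[R]_d,
     cell f C -> (minmax_closed C <-> bimonotone_polyhedron C)).
Proof.
have [J [a [c [ppiece fle fex]]]] := plc_pieces hf.
split; last first.
  move=> d1 C [C0 [P [[pP _ _] [b [e [_ eC]]]]]]; split; last exact: bimonotone_minmax_closed.
  apply: minmax_closed_bimonotone => //; rewrite eC.
  (* A face adds one equation to the polyhedron [P], written as two opposite inequalities. *)
  apply: polyhedralI; first exact/polyhedronE.
  have lN : linform (fun x : 'cV[R]_d => - (b *m x) 0 0).
    by move=> t x y; rewrite linform_row; ring.
  apply: eq_polyhedral (polyhedralI (polyhedral_halfspace e (linform_row b))
    (polyhedral_halfspace (- e) lN)) => x /=.
  by split=> [[]|]; [lra | move=> ->].
split=> [sf C [[x Cx] [P [regP faceCP]]]|hcell].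
  apply: (face_minmax_closed faceCP).
  have P0 : P !=set0 by have [b [e [_ eC]]] := faceCP; move: Cx; rewrite eC => -[Px _]; exists x.
  have [j ->] := region_is_piece ppiece fle fex regP P0.
  by apply: supermodular_piece.
have [fy cf _] := hf.
(* A nonempty piece is enlarged to a region, which is a face of itself and hence a min-max closed
   cell; an empty piece is kept. These sets still cover the domain. *)
have hK (j : J) : exists K : set 'cV[R]_d, [/\ polyhedral K, minmax_closed K,
    affine_on f K & piece f (a j) (c j) `<=` K].
  have [Q0|nQ] := pselect (piece f (a j) (c j) !=set0); last first.
    exists (piece f (a j) (c j)); split=> //; last exact: piece_affine_on.
    by move=> u v Qu; case: nQ; exists u.
  have [i [ji regi]] := piece_sub_region ppiece fle fex Q0.
  exists (piece f (a i) (c i)); split=> //; last exact: piece_affine_on.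
  apply: hcell; split; first by have [x Qx] := Q0; exists x; exact: ji.
  exists (piece f (a i) (c i)); split=> //; exists 0, 0; split.
    by move=> x _; rewrite mul0mx mxE.
  by apply/seteqP; split=> x /=; [move=> h; split=> //; rewrite mul0mx mxE | case].
have hK' j := projT2 (cid (hK j)).
apply: (supermodular_of_pieces fy cf (K := fun j => projT1 (cid (hK j)))) => [j|j|j|x].
- by have [] := hK' j.
- by have [] := hK' j.
- by have [] := hK' j.
by move=> /fex [j Qj]; exists j; have [_ _ _] := hK' j; exact.
Qed.
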